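(* Let $R$ be a ring. Then $R$ is Yaqub nil-clean if and only if (1) $J(R)$ is nil; and (2) $R/J(R)$ is isomorphic to a Boolean ring $R_1$, a Yaqub ring $R_2$, $\mathbb{Z}_5$, $R_1\times R_2$, or $R_1\times \mathbb{Z}_5$, where $R_1$ denotes some Boolean ring and $R_2$ some Yaqub ring.
   Context: All rings are associative with identity, not necessarily commutative. $J(R)$ denotes the Jacobson radical of $R$; it is nil if each of its elements is nilpotent. $\mathbb{Z}_n$ denotes $\mathbb{Z}/n\mathbb{Z}$. A ring $R$ is Yaqub nil-clean if for every $a\in R$, $a+a^3$ is nilpotent or $a-a^3$ is nilpotent. A ring is Boolean if $x^2=x$ for all its elements $x$. A ring is a Yaqub ring if it is a subdirect product of copies of $\mathbb{Z}_3$ (i.e. isomorphic to a subring of a direct product of copies of $\mathbb{Z}_3$ that projects onto each factor). *)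

(* Defs.v *)
From HB Require Import structures.
From mathcomp Require Import all_boot all_order all_algebra.
From mathcomp Require Import boolp classical_sets functions.

Set Implicit Arguments.
Unset Strict Implicit.
Unset Printing Implicit Defensive.

Import GRing.Theory.

Local Open Scope ring_scope.
Local Open Scope quotient_scope.
Local Open Scope classical_set_scope.

(* A ring is a [pzRingType]: associative, unital, possibly noncommutative, and
   possibly the zero ring. *)

(* [ring_quotient] only provides quotient rings of nonzero commutative rings,
   hence the following construction. *)

Definition two_sided_closed (R : pzRingType) (S : {pred R}) : Prop :=
  forall a x, x \in S -> a * x \in S /\ x * a \in S.

HB.mixin Record isTwoSided (R : pzRingType) (S : R -> bool) := {
  two_sided_subproof : two_sided_closed S
}.

#[short(type="two_sided_ideal")]
HB.structure Definition TwoSidedIdeal (R : pzRingType) :=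
  {S of GRing.ZmodClosed R S & isTwoSided R S}.

Definition quotient_ring (R : pzRingType) (I : two_sided_ideal R) : Type :=
  Quotient.quot I.

Section QuotientRing.
Variables (R : pzRingType) (I : two_sided_ideal R).
Local Notation Q := (quotient_ring I).

HB.instance Definition _ := GRing.Zmodule.on Q.
HB.instance Definition _ : EqQuotient R (Quotient.equiv I) Q :=
  EqQuotient.on Q.

Definition quotient_one : Q := lift_cst Q 1.
Definition quotient_mul : Q -> Q -> Q := lift_op2 Q *%R.

Lemma quotient_piE (x y : R) : (\pi_Q x = \pi_Q y) <-> (x - y \in I).
Proof. by rewrite (Quotient.idealrBE I); split=> /eqP. Qed.

Lemma quotient_pi_one : quotient_one = \pi_Q 1.
Proof. by rewrite /quotient_one; unlock. Qed.

Lemma quotient_pi_mul : {morph \pi_Q : x y / x * y >-> quotient_mul x y}.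
Proof.
move=> x y; rewrite /quotient_mul; unlock; apply/quotient_piE.
have Ix : x - repr (\pi_Q x) \in I by apply/quotient_piE; rewrite reprK.
have Iy : y - repr (\pi_Q y) \in I by apply/quotient_piE; rewrite reprK.
rewrite -[x * y](addrNK (x * repr (\pi_Q y))) -mulrBr -addrA -mulrBl.
by rewrite rpredD//; [have [] := two_sided_subproof x _ Iy
  | have [] := two_sided_subproof (repr (\pi_Q y)) _ Ix].
Qed.

Lemma quotient_mulA : associative quotient_mul.
Proof.
move=> x y z; elim/quotW: x => x; elim/quotW: y => y; elim/quotW: z => z.
by rewrite -!quotient_pi_mul mulrA.
Qed.

Lemma quotient_mul1 : left_id quotient_one quotient_mul.
Proof.
by move=> x; elim/quotW: x => x; rewrite quotient_pi_one -quotient_pi_mul mul1r.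
Qed.

Lemma quotient_mulr1 : right_id quotient_one quotient_mul.
Proof.
by move=> x; elim/quotW: x => x; rewrite quotient_pi_one -quotient_pi_mul mulr1.
Qed.

Lemma quotient_piD : {morph \pi_Q : x y / x + y >-> x + y}.
Proof. exact: (@Quotient.pi_add R I). Qed.

Lemma quotient_mulDl : left_distributive quotient_mul +%R.
Proof.
move=> x y z; elim/quotW: x => x; elim/quotW: y => y; elim/quotW: z => z.
by rewrite -quotient_piD -!quotient_pi_mul -quotient_piD mulrDl.
Qed.

Lemma quotient_mulDr : right_distributive quotient_mul +%R.
Proof.
move=> x y z; elim/quotW: x => x; elim/quotW: y => y; elim/quotW: z => z.
by rewrite -quotient_piD -!quotient_pi_mul -quotient_piD mulrDr.
Qed.

HB.instance Definition _ := GRing.Zmodule_isPzRing.Build Q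
  quotient_mulA quotient_mul1 quotient_mulr1 quotient_mulDl quotient_mulDr.

Definition quotient_proj (x : R) : Q := \pi_Q x.

Lemma quotient_proj_is_zmod_morphism : zmod_morphism quotient_proj.
Proof.
move=> x y; rewrite /quotient_proj quotient_piD; congr (_ + _).
exact: (@Quotient.pi_opp R I).
Qed.

Lemma quotient_proj_is_monoid_morphism : monoid_morphism quotient_proj.
Proof. by split=> [|x y]; [exact: esym quotient_pi_one|exact: quotient_pi_mul]. Qed.

HB.instance Definition _ := GRing.isZmodMorphism.Build R Q quotient_proj
  quotient_proj_is_zmod_morphism.
HB.instance Definition _ := GRing.isMonoidMorphism.Build R Q quotient_proj
  quotient_proj_is_monoid_morphism.

Lemma quotient_proj_surj (y : Q) : exists x, quotient_proj x = y.
Proof. by exists (repr y); rewrite /quotient_proj reprK. Qed.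

Lemma quotient_proj_eq0 (x : R) : (quotient_proj x = 0) <-> (x \in I).
Proof.
by rewrite -(raddf0 quotient_proj) /quotient_proj quotient_piE subr0.
Qed.

End QuotientRing.

Definition left_ideal (R : pzRingType) (M : set R) : Prop :=
  [/\ M 0, forall x y, M x -> M y -> M (x + y) & forall a x, M x -> M (a * x)].

Definition maximal_left_ideal (R : pzRingType) (M : set R) : Prop :=
  [/\ left_ideal M, M <> setT &
      forall N, left_ideal N -> M `<=` N -> N = M \/ N = setT].

(* For the zero ring there is no maximal left ideal, and the radical is the
   whole ring, that is 0. *)
Definition jacobson (R : pzRingType) : set R :=
  \bigcap_(M in @maximal_left_ideal R) M.
Arguments jacobson R : clear implicits.

(* The boolean form of [jacobson], which carries the ideal structure. *)
Definition jacobsonb (R : pzRingType) : R -> bool := fun x => x \in jacobson R.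
Arguments jacobsonb R : clear implicits.

Section JacobsonIdeal.
Variable R : pzRingType.

Lemma jacobsonbP (x : R) : reflect (jacobson R x) (x \in jacobsonb R).
Proof. by rewrite unfold_in; apply: (iffP idP); rewrite inE. Qed.

Lemma left_ideal_jacobson : left_ideal (jacobson R).
Proof.
split=> [M [[]]//|x y Jx Jy M Mmax|a x Jx M Mmax].
  by have [[_ MD _] _ _] := Mmax; apply: MD; [exact: Jx|exact: Jy].
by have [[_ _ MM] _ _] := Mmax; apply: MM; exact: Jx.
Qed.

Lemma maximal_left_ideal_colon (M : set R) (r : R) :
  maximal_left_ideal M -> ~ M r -> maximal_left_ideal [set x | M (x * r)].
Proof.
move=> [[M0 MD MM] _ Mmax] nMr; split.
- split=> [|x y /= Mx My|a x /= Mx]; first by rewrite /= mul0r.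
    by rewrite mulrDl; exact: MD.
  by rewrite -mulrA; exact: MM.
- move=> E; apply: nMr; have : [set x | M (x * r)] 1 by rewrite E.
  by rewrite /= mul1r.
move=> N [N0 ND NM] sub.
have [NE|/existsNP[z /not_implyP[Nz nMz]]] :=
  pselect (N `<=` [set x | M (x * r)]).
  by left; apply/seteqP.
right; apply/seteqP; split=> // y _.
pose P := [set x | exists s m, M m /\ x = s * (z * r) + m].
have PI : left_ideal P.
  split; first by exists 0, 0; rewrite mul0r addr0.
    move=> _ _ [s [m [Mm ->]]] [s' [m' [Mm' ->]]].
    by exists (s + s'), (m + m'); rewrite mulrDl addrACA; split=> //; exact: MD.
  move=> a _ [s [m [Mm ->]]]; exists (a * s), (a * m).
  by rewrite mulrDr !mulrA; split=> //; exact: MM.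
have MP : M `<=` P by move=> m Mm; exists 0, m; rewrite mul0r add0r.
case: (Mmax _ PI MP) => PE.
  case: nMz; rewrite /= -PE; exists 1, 0; rewrite mul1r addr0; split=> //.
have [s [m [Mm E]]] : P (y * r) by rewrite PE.
rewrite -(addrNK (s * z) y); apply: ND; last exact: NM.
by apply: sub; rewrite /= mulrBl E -mulrA addrAC subrr add0r.
Qed.

Lemma jacobson_mulr (x a : R) : jacobson R x -> jacobson R (x * a).
Proof.
move=> Jx M Mmax; have [Ma|nMa] := pselect (M a).
  by have [[_ _ MM] _ _] := Mmax; exact: MM.
exact: (Jx _ (maximal_left_ideal_colon Mmax nMa)).
Qed.

Lemma jacobsonb_zmod_closed : zmod_closed (jacobsonb R).
Proof.
have [J0 JD JM] := left_ideal_jacobson.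
split=> [|x y /jacobsonbP Jx /jacobsonbP Jy]; apply/jacobsonbP => //.
by apply: JD => //; rewrite -mulN1r; exact: JM.
Qed.

HB.instance Definition _ := GRing.isZmodClosed.Build R (jacobsonb R)
  jacobsonb_zmod_closed.

Lemma jacobsonb_two_sided : two_sided_closed (jacobsonb R).
Proof.
move=> a x /jacobsonbP Jx; split; apply/jacobsonbP; last exact: jacobson_mulr.
by have [_ _ JM] := left_ideal_jacobson; exact: JM.
Qed.

HB.instance Definition _ := isTwoSided.Build R (jacobsonb R)
  jacobsonb_two_sided.

End JacobsonIdeal.

Definition jacobson_quotient (R : pzRingType) : pzRingType :=
  quotient_ring (TwoSidedIdeal.clone R (jacobsonb R) _).

Definition nilpotent_elt (R : pzRingType) (x : R) : Prop :=
  exists n : nat, x ^+ n = 0.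

Definition nil_subset (R : pzRingType) (A : set R) : Prop :=
  forall x, A x -> nilpotent_elt x.

Definition yaqub_nil_clean (R : pzRingType) : Prop :=
  forall a : R, nilpotent_elt (a + a ^+ 3) \/ nilpotent_elt (a - a ^+ 3).

Definition boolean_ring (R : pzRingType) : Prop := forall x : R, x ^+ 2 = x.

(* [I -> 'Z_3] is the direct product of copies of Z/3Z indexed by [I], with
   pointwise operations; [I] may be infinite or empty. *)
Definition yaqub_ring (R : pzRingType) : Prop :=
  exists (I : Type) (f : {rmorphism R -> (I -> 'Z_3)}),
    injective f /\ forall i y, exists x, f x i = y.

Definition ring_iso (A B : pzRingType) : Prop :=
  exists f : {rmorphism A -> B}, bijective f.

(* Main.v *)
From HB Require Import structures.
Require Import Defs.
From mathcomp Require Import all_boot all_order all_algebra.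
From mathcomp Require Import boolp classical_sets functions.
From mathcomp Require Import ring.

Set Implicit Arguments.
Unset Strict Implicit.
Unset Printing Implicit Defensive.

Import GRing.Theory.

Local Open Scope ring_scope.
Local Open Scope quotient_scope.
Local Open Scope classical_set_scope.

(** Why the theorem is true.

    Let R be Yaqub nil-clean.  An element j of J(R) is nilpotent because j
    times the left-invertible element 1 + j^2, or 1 - j^2, is nilpotent.  The
    rest of this direction is about homomorphisms R -> Z_p with p = 2, 3, 5,
    called characters here: J(R) is exactly the set of elements killed by all
    of them.  One inclusion holds because nilpotents vanish in a field.  For
    the other, every maximal left ideal M contains the kernel of a character
    (character_off_maximal), for three reasons.

    - M is two-sided (maximal_left_ideal_right_stable).  If M r is not inside
      M, then M + M r = R, which leaves enough freedom to solve a quadratic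
      equation a^2 = a + t modulo M with t prescribed.  For t = -1 and t = 1,
      explicit multiples of a + a^3 and of a - a^3 are integers modulo M, so
      nilpotence of one of the two forces 3, respectively 5, into M; but
      1 = 2 * 3 - 5.
    - R / M is then a division ring in which x^3 = x or x^3 = - x holds for
      each x.  Taking x = 2 gives characteristic 2, 3 or 5.
    - In each of these characteristics, such identities make a product of
      factors x - i, with i an integer, vanish in R / M
      (maximal_left_ideal_residue); hence R / M is Z_p.

    Two further remarks on characters finish the proof.  The element 2 shows
    that 10 or 6 is nilpotent, so characters onto Z_3 and onto Z_5 do not
    coexist; and two characters onto Z_5 with different kernels could be
    combined into an element a with values 1 and 2, for which neither a + a^3
    nor a - a^3 is nilpotent.  Let K_p be the common kernel of the characters
    onto Z_p.  If there is no character onto Z_5, then J(R) is the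
    intersection of K_2 and K_3, and the Chinese remainder theorem, with the
    idempotent 3, splits R / J(R) into the Boolean ring R / K_2 and the Yaqub
    ring R / K_3.  If there is one onto Z_5, the same argument with the
    idempotent 5 gives R / K_2 times Z_5.  The zero ring being Boolean and
    Yaqub, these two forms cover the five of the statement.

    Conversely, each of the listed rings satisfies a + a^3 = 0 or a - a^3 = 0
    for every a, and this lifts from R / J(R) to R when J(R) is nil. *)

(** * Maximal left ideals *)

Section LeftIdeals.
Variable R : pzRingType.
Implicit Types (a b r x y z : R) (M N L : set R).

Lemma left_idealB L x y : left_ideal L -> L x -> L y -> L (x - y).
Proof.
by move=> [_ LD LM] Lx Ly; apply: LD => //; rewrite -mulN1r; exact: LM.
Qed.

Lemma left_ideal_sub L x y : left_ideal L -> L (x - y) -> L x <-> L y.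
Proof.
move=> Lid Lxy; split=> [Lx|Ly]; last first.
  by rewrite -(subrK y x); case: Lid => _ LD _; exact: LD.
by rewrite -[y](subKr x); exact: left_idealB.
Qed.

Lemma left_ideal1 L : left_ideal L -> L 1 -> L = setT.
Proof.
move=> [_ _ LM] L1; apply/seteqP; split=> // x _.
by rewrite -[x]mulr1; exact: LM.
Qed.

Lemma maximal_left_idealN1 M : maximal_left_ideal M -> ~ M 1.
Proof. by move=> [Mid MT _] /(left_ideal1 Mid). Qed.

(** The colon ideal of all x with x r in M is again maximal; once it contains
    M, it is M. *)
Lemma maximal_left_ideal_cancel M r x : maximal_left_ideal M -> ~ M r ->
  (forall m, M m -> M (m * r)) -> M (x * r) -> M x.
Proof.
move=> Mmax nMr Mr Mxr; have [Cid CT _] := maximal_left_ideal_colon Mmax nMr.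
by have [_ _ /(_ _ Cid Mr)[<-|/CT]] := Mmax.
Qed.

Lemma maximal_left_ideal_nat_exp M c n : maximal_left_ideal M ->
  M (c%:R ^+ n) -> M c%:R.
Proof.
move=> Mmax; have [[_ _ MM] _ _] := Mmax.
have [//|nMc] := pselect (M c%:R).
elim: n => [/(maximal_left_idealN1 Mmax)//|n IH].
rewrite exprSr => /(maximal_left_ideal_cancel Mmax nMc) H; apply/IH/H => m Mm.
by rewrite mulr_natr -mulr_natl; exact: MM.
Qed.

(** Modulo M, a multiple of b by an element commuting with b has a power that
    is zero.  If it is congruent to the integer c, that power is congruent to
    the same power of c because c is central; and an integer with a power in
    M is itself in M. *)
Lemma maximal_left_ideal_nilpotent M b x c : maximal_left_ideal M ->
  nilpotent_elt b -> GRing.comm x b -> M (x * b - c%:R) -> M c%:R.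
Proof.
move=> Mmax [n bn0] xb Mxb; have [Mid _ _] := Mmax; have [M0 MD MM] := Mid.
apply: (maximal_left_ideal_nat_exp (n := n)) => //.
suff : M ((x * b) ^+ n - c%:R ^+ n).
  by rewrite exprMn_comm// bn0 mulr0 => Mc; apply/(left_ideal_sub Mid Mc).
elim: n {bn0} => [|n IH]; first by rewrite !expr0 subrr.
have -> : (x * b) ^+ n.+1 - c%:R ^+ n.+1 =
  (x * b) ^+ n * (x * b - c%:R) + c%:R * ((x * b) ^+ n - c%:R ^+ n).
  by rewrite !mulrBr -exprSr -exprS commr_nat addrA subrK.
by apply: MD; exact: MM.
Qed.

(** Krull's theorem, by Zorn's lemma. *)
Lemma exists_maximal_left_ideal L : left_ideal L -> ~ L 1 ->
  exists2 M, maximal_left_ideal M & L `<=` M.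
Proof.
move=> Lid nL1; have [L0 _ _] := Lid.
(* The empty set is admitted so that the empty chain has an upper bound. *)
pose P := [set X : set R | X = set0 \/ [/\ left_ideal X, ~ X 1 & L `<=` X]].
have Pchain F : F `<=` P -> total_on F subset -> P (\bigcup_(X in F) X).
  move=> FP Ftot; have [[X0 FX0 [z X0z]]|F0] :=
    pselect (exists2 X, F X & X !=set0); last first.
    left; rewrite -subset0 => x [X FX Xx].
    by case: F0; exists X => //; exists x.
  have FI X x : F X -> X x -> [/\ left_ideal X, ~ X 1 & L `<=` X].
    by move=> FX Xx; case: (FP _ FX) => // X0E; rewrite X0E in Xx.
  right; split.
  - split.
    + by have [_ _ LX] := FI _ _ FX0 X0z; exists X0 => //; exact: LX.
    + move=> x y [X FX Xx] [Y FY Yy].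
      have [[_ XD _] _ _] := FI _ _ FX Xx; have [[_ YD _] _ _] := FI _ _ FY Yy.
      case: (Ftot _ _ FX FY) => [XY|YX].
        by exists Y => //; apply: YD => //; exact: XY.
      by exists X => //; apply: XD => //; exact: YX.
    + move=> a x [X FX Xx]; have [[_ _ XM] _ _] := FI _ _ FX Xx.
      by exists X => //; exact: XM.
  - by move=> [X FX X1]; have [_] := FI _ _ FX X1.
  - move=> x Lx; have [_ _ LX] := FI _ _ FX0 X0z.
    by exists X0 => //; exact: LX.
have [M [PM Mmax]] := Zorn_bigcup Pchain.
have PL : P L by right; split.
case: PM => [M0|[Mid nM1 LM]].
  case: (Mmax L) => //; rewrite M0; split=> [x []//|/(_ _ L0)[]].
exists M => //; split=> //; first by move=> MT; apply: nM1; rewrite MT.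
move=> N Nid MN; have [N1|nN1] := pselect (N 1).
  by right; exact: left_ideal1.
left; apply/seteqP; split=> //; apply: contrapT => nNM.
apply: (Mmax N); first by split.
by right; split=> // x /LM; exact: MN.
Qed.

Lemma jacobson_left_unit x : jacobson R x -> exists u, u * (1 + x) = 1.
Proof.
move=> Jx; pose L := [set y | exists u, u * (1 + x) = y].
have Lid : left_ideal L.
  split; first by exists 0; rewrite mul0r.
    by move=> _ _ [u <-] [v <-]; exists (u + v); rewrite mulrDl.
  by move=> a _ [u <-]; exists (a * u); rewrite mulrA.
apply: contrapT => nL1; have [M Mmax LM] := exists_maximal_left_ideal Lid nL1.
apply: (maximal_left_idealN1 Mmax); have [Mid _ _] := Mmax.
rewrite -(addrK x 1); apply: left_idealB => //; last exact: Jx.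
by apply: LM; exists 1; rewrite mul1r.
Qed.

(** The subring generated by one element is commutative: identities between
    polynomial expressions in a are proved in Z[X] and transported by this
    evaluation. *)
Lemma int_poly_eval a : 1 != 0 :> R ->
  exists ev : {rmorphism {poly int} -> R}, ev 'X = a.
Proof.
move=> R1; pose R' : nzRingType :=
  HB.pack R (GRing.PzSemiRing_isNonZero.Build R R1).
have ca : commr_rmorph (intr : int -> R') (a : R').
  by move=> n; exact: commr_int.
pose ev : {rmorphism {poly int} -> R'} := horner_morph ca.
by exists ev; exact: (horner_morphX ca).
Qed.

End LeftIdeals.

(** * Maximal left ideals of a Yaqub nil-clean ring *)

Section YaqubNilClean.
Variable R : pzRingType.
Hypothesis RY : yaqub_nil_clean R.
Implicit Types (a b r x y z : R) (M N L : set R).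

(** The nilpotent element j + j^3 or j - j^3 is j (1 + x) with x = j^2 or
    - j^2 in the radical, and 1 + x is left invertible and commutes with j. *)
Lemma jacobson_nil : nil_subset (jacobson R).
Proof.
move=> j Jj; have [_ _ JM] := left_ideal_jacobson R.
suff H x : jacobson R x -> GRing.comm x j -> nilpotent_elt (j * (1 + x)) ->
    nilpotent_elt j.
  have Jj2 : jacobson R (j ^+ 2) by rewrite expr2; exact: JM.
  case: (RY j) => jn.
    apply: (H (j ^+ 2)) => //; first exact/commr_sym/commrX.
    by rewrite mulrDr mulr1 -exprS.
  apply: (H (- j ^+ 2)); first by rewrite -mulN1r; exact: JM.
    by apply/commr_sym/commrN/commrX.
  by rewrite mulrDr mulr1 mulrN -exprS.
move=> Jx xj [n]; rewrite exprMn_comm; last first.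
  by apply: commrD; [exact: commr1|exact: commr_sym].
have [u u1] := jacobson_left_unit Jx => jn0; exists n.
have comm_1x : GRing.comm (j ^+ n) ((1 + x) ^+ n).
  apply/commrX/commr_sym/commrX/commr_sym; apply: commrD; first exact: commr1.
  exact: commr_sym.
rewrite comm_1x in jn0.
have un : u ^+ n * (1 + x) ^+ n = 1.
  elim: n {jn0 comm_1x} => [|n IH]; first by rewrite mulr1.
  by rewrite exprSr exprS -mulrA (mulrA u) u1 mul1r.
by rewrite -[j ^+ n]mul1r -un -mulrA jn0 mulr0.
Qed.

(** A very small case of the density theorem for the simple module R / M.  As
    M + M r = R, some m in M has m r = r + t - r^2 modulo M.  Then a = r + m
    is r modulo M, so a^2 is a r = r^2 + m r, that is r + t. *)
Lemma quadratic_mod_maximal M r m0 t : maximal_left_ideal M ->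
  M m0 -> ~ M (m0 * r) -> exists a, M (a ^+ 2 - (a + t)).
Proof.
move=> [Mid MT Mmax] Mm0 nMm0r; have [M0 MD MM] := Mid.
pose N := [set y | exists m, M m /\ M (y - m * r)].
have Nid : left_ideal N.
  split; first by exists 0; rewrite mul0r subr0.
    move=> y z [m [Mm My]] [n [Mn Mz]]; exists (m + n); split; first exact: MD.
    by rewrite mulrDl opprD addrACA; exact: MD.
  move=> a y [m [Mm My]]; exists (a * m); split; first exact: MM.
  by rewrite -mulrA -mulrBr; exact: MM.
have MN : M `<=` N by move=> y My; exists 0; rewrite mul0r subr0.
have NT : N = setT.
  case: (Mmax _ Nid MN) => // NM; case: nMm0r; rewrite -NM.
  by exists m0; rewrite subrr.
have [m [Mm Mmr]] : N (r + t - r * r) by rewrite NT.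
exists (r + m); rewrite expr2.
have -> : (r + m) * (r + m) - (r + m + t) =
  (r + m) * m - m - (r + t - r * r - m * r).
  rewrite -(addrA (r + t)) -opprD -mulrDl opprB addrACA -opprD.
  rewrite [in LHS]mulrDr [RHS]addrC [RHS]addrA [RHS]addrC.
  by rewrite [in RHS](addrC (- _)) !addrA (addrC m r).
by apply: left_idealB => //; apply: left_idealB => //; exact: MM.
Qed.

(** If M r were not inside M, the previous lemma would provide a root a of
    X^2 - X + 1 modulo M, and also one of X^2 - X - 1.  In Z[X] modulo the
    first polynomial, X + X^3 is invertible and X - X^3 has norm 3; modulo the
    second, X + X^3 has norm -5 and X - X^3 is invertible.  Nilpotence
    of a + a^3 or a - a^3 thus puts both 3 and 5 in M. *)
Lemma maximal_left_ideal_right_stable M m r : maximal_left_ideal M ->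
  M m -> M (m * r).
Proof.
move=> Mmax Mm; apply: contrapT => nMmr; have [Mid _ _] := Mmax.
have [M0 MD MM] := Mid; have nM1 := maximal_left_idealN1 Mmax.
have R1 : 1 != 0 :> R by apply/eqP => E; apply: nM1; rewrite E.
(* xp and xm invert X + X^3 and X - X^3 up to the integers cp and cm; p and q
   are the quotients by X^2 - X - t. *)
have excluded (t : int) (cp cm : nat) (p q xp xm : {poly int}) :
    xp * ('X + 'X ^+ 3) - cp%:R = p * ('X ^+ 2 - ('X + t%:~R)) ->
    xm * ('X - 'X ^+ 3) - cm%:R = q * ('X ^+ 2 - ('X + t%:~R)) ->
    M cp%:R \/ M cm%:R.
  move=> Ep Em; have [a Ma] := quadratic_mod_maximal t%:~R Mmax Mm nMmr.
  have [ev eva] := int_poly_eval a R1.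
  have evM u : M (ev (u * ('X ^+ 2 - ('X + t%:~R)))).
    by rewrite rmorphM rmorphB rmorphXn rmorphD rmorph_int eva; exact: MM.
  have comm_ev u v : GRing.comm (ev u) (ev v).
    by rewrite /GRing.comm -!rmorphM mulrC.
  case: (RY a) => an; [left|right].
    apply: (maximal_left_ideal_nilpotent (x := ev xp) Mmax an).
      by rewrite -eva -rmorphXn -rmorphD.
    rewrite -(rmorph_nat ev) -eva -rmorphXn -rmorphD -rmorphM -rmorphB Ep.
    exact: evM.
  apply: (maximal_left_ideal_nilpotent (x := ev xm) Mmax an).
    by rewrite -eva -rmorphXn -rmorphB.
  rewrite -(rmorph_nat ev) -eva -rmorphXn -rmorphB -rmorphM -rmorphB Em.
  exact: evM.
have M3 : M 3%:R.
  case: (@excluded (-1) 1 3 (- ('X^2 + 'X + 1)) ('X^2 - 'X - 3%:R)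
    (- 'X) (2%:R - 'X)); by [ring|move/nM1|].
have M5 : M 5%:R.
  case: (@excluded 1 5 1 (3%:R * 'X^2 - 'X + 5%:R) (- 'X^2 + 'X + 1)
    (3%:R * 'X - 4%:R) ('X - 2%:R)); by [ring|move/nM1|].
apply: nM1; rewrite (_ : 1 = 2%:R * 3%:R - 5%:R); last by rewrite -natrM -natrB.
by apply: left_idealB => //; exact: MM.
Qed.

Lemma maximal_left_ideal_prime M x y : maximal_left_ideal M ->
  M (x * y) -> M x \/ M y.
Proof.
move=> Mmax Mxy; have [My|nMy] := pselect (M y); [by right|left].
apply: (maximal_left_ideal_cancel Mmax nMy) Mxy => m.
exact: maximal_left_ideal_right_stable.
Qed.

Lemma nilpotent_sub_maximal M x : maximal_left_ideal M ->
  nilpotent_elt x -> M x.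
Proof.
move=> Mmax [n xn0]; have [[M0 _ _] _ _] := Mmax.
have : M (x ^+ n) by rewrite xn0.
elim: n {xn0} => [/(maximal_left_idealN1 Mmax)//|n IH]; rewrite exprS.
by case/(maximal_left_ideal_prime Mmax).
Qed.

(** For a = 2, the two expressions of the hypothesis are 10 and -6. *)
Lemma maximal_left_ideal_pchar M : maximal_left_ideal M ->
  exists2 p, p \in [:: 2; 3; 5]%N & M p%:R.
Proof.
move=> Mmax; case: (RY 2%:R) => /(nilpotent_sub_maximal Mmax).
  rewrite (_ : _ + _ = 2%:R * 5%:R); last by rewrite -natrX -natrD -natrM.
  by case/(maximal_left_ideal_prime Mmax) => ?; [exists 2%N|exists 5%N].
rewrite -opprB (_ : _ - 2%:R = 2%:R * 3%:R); last first.
  by rewrite -natrX -natrB// -natrM.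
have [[M0 _ _] _ _] := Mmax; have [Mid _ _] := Mmax.
move=> /(left_idealB Mid M0); rewrite sub0r opprK.
by case/(maximal_left_ideal_prime Mmax) => ?; [exists 2%N|exists 3%N].
Qed.

Lemma residue_of_prod M (s : seq nat) a : maximal_left_ideal M ->
  M (\prod_(i <- s) (a - i%:R)) -> exists n : nat, M (a - n%:R).
Proof.
move=> Mmax; elim: s => [|i s IH].
  by rewrite big_nil => /(maximal_left_idealN1 Mmax).
rewrite big_cons => /(maximal_left_ideal_prime Mmax)[Mi|/IH//].
by exists i.
Qed.

(** Modulo p, the product of the X - i, for i in a suitable list of integers,
    is a multiple of X - X^3, and also of X + X^3 unless p = 3.  For p = 2 the
    list repeats 1, because X + X^3 is X (X - 1)^2.
    In that last case X^2 + 1 is irreducible; if a + a^3 is in M, the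
    hypothesis at a + 1 then shows that a itself lies in M. *)
Lemma maximal_left_ideal_residue M p a : maximal_left_ideal M ->
  p \in [:: 2; 3; 5]%N -> M p%:R -> exists n : nat, M (a - n%:R).
Proof.
move=> Mmax pP Mp; have nM1 := maximal_left_idealN1 Mmax.
have [Mid _ _] := Mmax; have [M0 MD MM] := Mid.
have R1 : 1 != 0 :> R by apply/eqP => E; apply: nM1; rewrite E.
have [ev eva] := int_poly_eval a R1.
have evM u v : M (ev v) -> M (ev (u * v)) by rewrite rmorphM; exact: MM.
have evD u v : M (ev u) -> M (ev v) -> M (ev (u + v)).
  by rewrite rmorphD; exact: MD.
have evp u : M (ev (u * p%:R)) by apply: evM; rewrite rmorph_nat.
have evRY (u : {poly int}) : M (ev (u + u ^+ 3)) \/ M (ev (u - u ^+ 3)).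
  rewrite rmorphD rmorphB rmorphXn.
  by case: (RY (ev u)) => /(nilpotent_sub_maximal Mmax); [left|right].
have res (s : seq nat) : M (ev (\prod_(i <- s) ('X - i%:R))) ->
    exists n : nat, M (a - n%:R).
  move=> H; apply: (@residue_of_prod M s) => //; move: H; rewrite rmorph_prod.
  by under eq_bigr do rewrite rmorphB rmorph_nat eva.
have comb (c d u w : {poly int}) : M (ev u) -> w = c * u + d * p%:R -> M (ev w).
  by move=> Mu ->; apply: evD => //; exact: evM.
move: pP; rewrite !inE => /or3P[]/eqP pE; move: comb; rewrite pE {evp} => comb.
- apply: (res [:: 0; 1; 1]%N); rewrite !big_cons big_nil.
  case: (evRY 'X) => H.
    by apply: (comb 1 (- 'X ^+ 2) _ _ H); ring.
  by apply: (comb (-1) ('X - 'X ^+ 2) _ _ H); ring.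
- case: (evRY 'X) => H; last first.
    apply: (res [:: 0; 1; 2]%N); rewrite !big_cons big_nil.
    by apply: (comb (-1) ('X - 'X ^+ 2) _ _ H); ring.
  exists 0%N; rewrite subr0 -eva.
  case: (evRY ('X + 1)) => H1.
    case: nM1; rewrite -(rmorph1 ev).
    have H2 : M (ev (-1 * ('X + 'X ^+ 3) + ('X + 1 + ('X + 1) ^+ 3))).
      by apply: evD => //; exact: evM.
    by apply: (comb (-1) (1 + 'X + 'X^2) _ _ H2); ring.
  have H2 := evD _ _ H H1.
  by apply: (comb (-1) (- 'X ^+ 2) _ _ H2); ring.
- apply: (res [:: 0; 1; 2; 3; 4]%N); rewrite !big_cons big_nil.
  pose d : {poly int} :=
    - 2%:R * 'X ^+ 4 + 7%:R * 'X ^+ 3 - 10%:R * 'X ^+ 2 + 5%:R * 'X.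
  case: (evRY 'X) => H.
    by apply: (comb ('X ^+ 2 - 1) d _ _ H); rewrite /d; ring.
  by apply: (comb (- ('X ^+ 2 + 1)) d _ _ H); rewrite /d; ring.
Qed.

End YaqubNilClean.

(** * Characters with values in Z_p *)

Lemma natr_Zp_eq0 p n : (1 < p)%N -> (n%:R == 0 :> 'Z_p) = (p %| n)%N.
Proof. by move=> p_gt1; rewrite -val_eqE /= val_Zp_nat. Qed.

Section Characters.
Variable R : pzRingType.

(** A two-sided proper ideal containing p and meeting each class a + Z is the
    kernel of a homomorphism to Z_p: send a to any integer congruent to it.
    All the verifications follow from uniqueness modulo p of this integer. *)
Lemma character_of_residues (M : set R) p : left_ideal M -> ~ M 1 ->
  prime p -> M p%:R -> (forall a, exists n : nat, M (a - n%:R)) ->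
  (forall m r, M m -> M (m * r)) ->
  exists chi : {rmorphism R -> 'Z_p}, forall a, chi a = 0 -> M a.
Proof.
move=> Mid nM1 p_pr Mp Mres Mr; have [M0 MD MM] := Mid.
have p_gt1 := prime_gt1 p_pr.
have dvdM n : M n%:R <-> (p %| n)%N.
  split=> [Mn|/dvdnP[k ->]]; last by rewrite natrM; exact: MM.
  have [//|] := boolP (p %| n)%N; rewrite -prime_coprime//.
  move=> /(coprimeP _ (prime_gt0 p_pr))[[u v] /= uv1]; case: nM1.
  have vu : (v * n <= u * p)%N by rewrite ltnW// -subn_gt0 uv1.
  rewrite -[1]/(1%:R) -uv1 natrB// !natrM.
  by apply: left_idealB => //; exact: MM.
have ZM m n : M (m%:R - n%:R) -> m%:R = n%:R :> 'Z_p.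
  wlog nm : m n / (n <= m)%N => [H|]; last first.
    rewrite -natrB// => /dvdM; rewrite -natr_Zp_eq0// natrB// subr_eq0.
    by move/eqP.
  have /orP[nm|mn] := leq_total n m; first exact: H.
  move=> /(left_idealB Mid M0); rewrite sub0r opprB => Mnm; exact/esym/H.
pose n_ a := sval (cid (Mres a)).
have n_P a : M (a - (n_ a)%:R) by rewrite /n_; case: cid.
pose chi a : 'Z_p := (n_ a)%:R.
have chiE a n : M (a - n%:R) -> chi a = n%:R.
  move=> Man; apply: ZM; rewrite -(subrKA a) addrC -opprB.
  exact: left_idealB.
have chi_nmod : nmod_morphism chi.
  split=> [|x y]; first by rewrite (chiE _ 0%N)// subrr.
  rewrite (chiE _ (n_ x + n_ y)%N) ?natrD//.
  by rewrite opprD addrACA; apply: MD.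
have chi_monoid : monoid_morphism chi.
  split=> [|x y]; first by rewrite (chiE _ 1%N)// subrr.
  rewrite (chiE _ (n_ x * n_ y)%N) ?natrM//.
  rewrite -(subrKA (x * (n_ y)%:R)) -mulrBr -mulrBl; apply: MD; first exact: MM.
  exact: Mr.
pose chi' : {rmorphism R -> 'Z_p} := HB.pack chi
  (GRing.isNmodMorphism.Build R 'Z_p chi chi_nmod)
  (GRing.isMonoidMorphism.Build R 'Z_p chi chi_monoid).
exists chi' => a /= chi0; apply/(left_ideal_sub Mid (n_P a)).
by apply/dvdM; rewrite -natr_Zp_eq0//; exact/eqP.
Qed.
End Characters.

Lemma character_off_maximal (R : pzRingType) (M : set R) :
  yaqub_nil_clean R -> maximal_left_ideal M ->
  exists2 p, p \in [:: 2; 3; 5]%N &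
    exists chi : {rmorphism R -> 'Z_p}, forall a, chi a = 0 -> M a.
Proof.
move=> RY Mmax; have [p pP Mp] := maximal_left_ideal_pchar RY Mmax.
exists p => //; have [Mid _ _] := Mmax.
apply: (character_of_residues Mid (maximal_left_idealN1 Mmax) _ Mp).
- by move: pP; rewrite !inE => /or3P[]/eqP->.
- by move=> a; exact: (maximal_left_ideal_residue RY a Mmax pP Mp).
- by move=> m r; exact: (maximal_left_ideal_right_stable RY).
Qed.

Lemma rmorph_nilpotent (R S : pzRingType) (f : {rmorphism R -> S}) x :
  nilpotent_elt x -> nilpotent_elt (f x).
Proof. by move=> [n xn0]; exists n; rewrite -rmorphXn xn0 rmorph0. Qed.

Lemma nilpotent_Zp p (x : 'Z_p) : prime p -> nilpotent_elt x -> x = 0.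
Proof.
move=> p_pr [n]; have p_gt1 := prime_gt1 p_pr.
rewrite -[x]natr_Zp -natrX => /eqP; rewrite natr_Zp_eq0// Euclid_dvdX//.
by move=> /andP[px _]; apply/eqP; rewrite natr_Zp_eq0.
Qed.

(** * The common kernel of the characters onto Z_p *)

(** A boolean predicate, since ideals are structures carried by such. *)
Definition char_kernel (p : nat) (R : pzRingType) : R -> bool :=
  fun x => `[< forall chi : {rmorphism R -> 'Z_p}, chi x = 0 >].
Arguments char_kernel p R : clear implicits.

Section CharKernel.
Variables (p : nat) (R : pzRingType).

Lemma char_kernelP (x : R) :
  (x \in char_kernel p R) <-> forall chi : {rmorphism R -> 'Z_p}, chi x = 0.
Proof. by rewrite unfold_in; split=> [/asboolP|?]; last exact/asboolP. Qed.

Lemma char_kernel_zmod_closed : zmod_closed (char_kernel p R).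
Proof.
split=> [|x y /char_kernelP x0 /char_kernelP y0]; apply/char_kernelP => chi.
  exact: rmorph0.
by rewrite rmorphB x0 y0 subrr.
Qed.

HB.instance Definition _ := GRing.isZmodClosed.Build R (char_kernel p R)
  char_kernel_zmod_closed.

Lemma char_kernel_two_sided : two_sided_closed (char_kernel p R).
Proof.
move=> a x /char_kernelP x0; split; apply/char_kernelP => chi.
  by rewrite rmorphM x0 mulr0.
by rewrite rmorphM x0 mul0r.
Qed.

HB.instance Definition _ := isTwoSided.Build R (char_kernel p R)
  char_kernel_two_sided.

End CharKernel.

Definition char_quotient (p : nat) (R : pzRingType) : pzRingType :=
  quotient_ring (TwoSidedIdeal.clone R (char_kernel p R) _).

Definition char_proj (p : nat) (R : pzRingType) :
    {rmorphism R -> char_quotient p R} :=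
  @quotient_proj R (TwoSidedIdeal.clone R (char_kernel p R) _).

(** * Homomorphisms out of a quotient *)

Section FactorThroughQuotient.
Variables (R T : pzRingType) (I : two_sided_ideal R) (f : {rmorphism R -> T}).

Lemma quotient_lift : (forall x, x \in I -> f x = 0) ->
  exists g : {rmorphism quotient_ring I -> T},
    forall x, g (quotient_proj I x) = f x.
Proof.
move=> fI; pose g (y : quotient_ring I) : T := f (repr y).
have gE x : g (quotient_proj I x) = f x.
  apply/eqP; rewrite -subr_eq0 -rmorphB; apply/eqP/fI/quotient_piE.
  exact: reprK.
have g_zmod : zmod_morphism g.
  move=> x y; have [u <-] := quotient_proj_surj x.
  by have [v <-] := quotient_proj_surj y; rewrite -rmorphB !gE rmorphB.
have g_monoid : monoid_morphism g.
  split; first by rewrite -(rmorph1 (quotient_proj I)) gE rmorph1.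
  move=> x y; have [u <-] := quotient_proj_surj x.
  by have [v <-] := quotient_proj_surj y; rewrite -rmorphM !gE rmorphM.
pose g' : {rmorphism quotient_ring I -> T} := HB.pack g
  (GRing.isZmodMorphism.Build (quotient_ring I) T g g_zmod)
  (GRing.isMonoidMorphism.Build (quotient_ring I) T g g_monoid).
by exists g'; exact: gE.
Qed.

(** The first isomorphism theorem. *)
Lemma quotient_iso : (forall y, exists x, f x = y) ->
  (forall x, x \in I <-> f x = 0) -> ring_iso (quotient_ring I) T.
Proof.
move=> fsurj fI; have [g gE] := quotient_lift (fun x => (fI x).1).
exists g; have ginj : injective g.
  move=> x y; have [u <-] := quotient_proj_surj x.
  have [v <-] := quotient_proj_surj y; rewrite !gE => fuv.
  by apply/quotient_piE/fI; rewrite rmorphB fuv subrr.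
have /choice[h hK] : forall y, exists x, g x = y.
  by move=> y; have [x <-] := fsurj y; exists (quotient_proj I x).
by exists h => // x; apply: ginj.
Qed.

End FactorThroughQuotient.

(** The Chinese remainder theorem: e is sent to (1, 0), which makes the pair
    of f and g surjective. *)
Lemma quotient_iso_pair (R A B : pzRingType) (I : two_sided_ideal R)
    (f : {rmorphism R -> A}) (g : {rmorphism R -> B}) e :
  (forall y, exists x, f x = y) -> (forall y, exists x, g x = y) ->
  f e = 1 -> g e = 0 ->
  (forall x, x \in I <-> f x = 0 /\ g x = 0) ->
  ring_iso (quotient_ring I) (A * B)%type.
Proof.
move=> fsurj gsurj fe ge IE; pose h x : (A * B)%type := (f x, g x).
have h_zmod : zmod_morphism h by move=> x y; rewrite /h !rmorphB.
have h_monoid : monoid_morphism h.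
  by split=> [|x y]; rewrite /h ?rmorph1 ?rmorphM.
pose h' : {rmorphism R -> (A * B)%type} := HB.pack h
  (GRing.isZmodMorphism.Build R (A * B)%type h h_zmod)
  (GRing.isMonoidMorphism.Build R (A * B)%type h h_monoid).
apply: (@quotient_iso _ _ _ h') => [[a b]|x].
  have [x fx] := fsurj a; have [y gy] := gsurj b.
  exists (x * e + y * (1 - e)).
  rewrite /= /h !rmorphD !rmorphM !rmorphB !rmorph1 fe ge fx gy.
  by rewrite !mulr1 !mulr0 subrr subr0 mulr0 mulr1 addr0 add0r.
by rewrite IE /= /h; split=> [[-> ->]//|[-> ->]].
Qed.

(** * The Boolean and the Yaqub factor *)

Lemma character_surj (p : nat) (R : pzRingType)
  (chi : {rmorphism R -> 'Z_p}) y : exists x, chi x = y.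
Proof. by exists (nat_of_ord y)%:R; rewrite rmorph_nat natr_Zp. Qed.

Lemma char_proj_eq0 p (R : pzRingType) (x : R) :
  char_proj p R x = 0 <-> forall chi : {rmorphism R -> 'Z_p}, chi x = 0.
Proof. by rewrite quotient_proj_eq0 char_kernelP. Qed.

Lemma char_quotient2_boolean (R : pzRingType) :
  boolean_ring (char_quotient 2 R).
Proof.
move=> x; have [u <-] := quotient_proj_surj x; rewrite -rmorphXn.
apply/quotient_piE/char_kernelP => chi; rewrite rmorphB rmorphXn.
by case: (chi u) => [[|[|[]]]]// ?; apply/val_inj.
Qed.

(** The quotient embeds in the product of copies of Z_3 indexed by all the
    characters onto Z_3, through evaluation. *)
Lemma char_quotient3_yaqub (R : pzRingType) : yaqub_ring (char_quotient 3 R).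
Proof.
pose P : pzRingType := {rmorphism R -> 'Z_3} -> 'Z_3.
pose phi (x : R) : P := fun chi => chi x.
have phi_zmod : zmod_morphism phi.
  by move=> x y; apply/funext => chi; exact: rmorphB.
have phi_monoid : monoid_morphism phi.
  by split=> [|x y]; apply/funext => chi; [exact: rmorph1|exact: rmorphM].
pose phi' : {rmorphism R -> P} := HB.pack phi
  (GRing.isZmodMorphism.Build R P phi phi_zmod)
  (GRing.isMonoidMorphism.Build R P phi phi_monoid).
have phi0 x : x \in char_kernel 3 R -> phi' x = 0.
  by move=> /char_kernelP x0; apply/funext.
have [f fE] := @quotient_lift _ _
  (TwoSidedIdeal.clone R (char_kernel 3 R) _) phi' phi0.
exists {rmorphism R -> 'Z_3}, f; split=> [x y|chi y]; last first.
  by have [x <-] := character_surj chi y; exists (char_proj 3 R x); rewrite fE.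
have [u <-] := quotient_proj_surj x; have [v <-] := quotient_proj_surj y.
rewrite !fE => uv; apply/quotient_piE/char_kernelP => chi.
rewrite rmorphB; have /= := congr1 (@^~ chi) uv; rewrite /phi => ->.
exact: subrr.
Qed.

(** * Characters of a Yaqub nil-clean ring *)

Section YaqubCharacters.
Variable R : pzRingType.
Hypothesis RY : yaqub_nil_clean R.

(** The radical is nil and Z_p has no nonzero nilpotent, so characters kill the
    radical; conversely each maximal left ideal contains the kernel of one. *)
Lemma jacobson_characters (x : R) : jacobson R x <->
  forall p, p \in [:: 2; 3; 5]%N ->
  forall chi : {rmorphism R -> 'Z_p}, chi x = 0.
Proof.
split=> [Jx p pP chi|x0 M Mmax].
  apply: nilpotent_Zp; first by move: pP; rewrite !inE => /or3P[]/eqP->.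
  exact/rmorph_nilpotent/(jacobson_nil RY).
by have [p pP [chi]] := character_off_maximal RY Mmax; apply; exact: x0.
Qed.

(** Either 10, which is 1 in Z_3, or -6, which is -1 in Z_5, is nilpotent. *)
Lemma characters_3_5_exclusive (chi : {rmorphism R -> 'Z_3})
  (psi : {rmorphism R -> 'Z_5}) : False.
Proof.
case: (RY 2%:R) => R2.
  have := nilpotent_Zp (isT : prime 3) (rmorph_nilpotent chi R2).
  by rewrite rmorphD rmorphXn rmorph_nat.
have := nilpotent_Zp (isT : prime 5) (rmorph_nilpotent psi R2).
by rewrite rmorphB rmorphXn rmorph_nat.
Qed.

(** An element x killed by chi but not by psi yields, by scaling and adding 1,
    an element a with chi a = 1 and psi a = 2.  Then chi (a + a^3) = 2 and
    psi (a - a^3) = -6 are both nonzero in Z_5. *)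
Lemma character5_unique (chi psi : {rmorphism R -> 'Z_5}) x :
  chi x = 0 -> psi x = 0.
Proof.
move=> chix; apply: contrapT => /eqP psix.
have [y psiy] : exists y, psi x * y = 1.
  move: psix; case: (psi x) => [[|[|[|[|[|]]]]]]// ? _.
  - by exists 1; exact/val_inj.
  - by exists 3%:R; exact/val_inj.
  - by exists 2%:R; exact/val_inj.
  - by exists 4%:R; exact/val_inj.
pose a := 1 + x * (nat_of_ord y)%:R.
have chia : chi a = 1 by rewrite rmorphD rmorph1 rmorphM chix mul0r addr0.
have psia : psi a = 2%:R.
  by rewrite rmorphD rmorph1 rmorphM rmorph_nat natr_Zp psiy.
case: (RY a) => an.
  have := nilpotent_Zp (isT : prime 5) (rmorph_nilpotent chi an).
  by rewrite rmorphD rmorphXn chia.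
have := nilpotent_Zp (isT : prime 5) (rmorph_nilpotent psi an).
by rewrite rmorphB rmorphXn psia.
Qed.

End YaqubCharacters.

(** * The converse direction *)

Lemma yaqub_identity_nil_clean (R : pzRingType) :
  nil_subset (jacobson R) ->
  (forall a : jacobson_quotient R, a + a ^+ 3 = 0 \/ a - a ^+ 3 = 0) ->
  yaqub_nil_clean R.
Proof.
move=> Jnil Q a.
pose pi := quotient_proj (TwoSidedIdeal.clone R (jacobsonb R) _).
have nil x : pi x = 0 -> nilpotent_elt x.
  by move=> /quotient_proj_eq0/jacobsonbP; exact: Jnil.
by case: (Q (pi a)); rewrite -rmorphXn -?rmorphB -?rmorphD => /nil;
  [left|right].
Qed.

Lemma boolean_ring_identities (R : pzRingType) (a : R) : boolean_ring R ->
  a + a ^+ 3 = 0 /\ a - a ^+ 3 = 0.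
Proof.
move=> RB; have -> : a ^+ 3 = a by rewrite exprS RB -expr2 RB.
split; last exact: subrr.
have : (a + a) ^+ 2 = a + a by rewrite RB.
by rewrite expr2 mulrDl mulrDr -expr2 RB => /(canRL (addrK _)); rewrite subrr.
Qed.

Lemma yaqub_ring_identity (R : pzRingType) (a : R) : yaqub_ring R ->
  a - a ^+ 3 = 0.
Proof.
move=> [I [f [finj _]]]; apply: finj; rewrite rmorph0 rmorphB rmorphXn.
apply/funext => i; rewrite /=.
have Z3 (z : 'Z_3) : z - z ^+ 3 = 0.
  by case: z => [[|[|[|]]]]// ?; exact/val_inj.
exact: (Z3 (f a i)).
Qed.

Lemma Z5_identities (a : 'Z_5) : a + a ^+ 3 = 0 \/ a - a ^+ 3 = 0.
Proof.
by case: a => [[|[|[|[|[|]]]]]]// ?; [left|right|left|left|right];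
  exact/val_inj.
Qed.

Lemma ring_iso_identities (A B : pzRingType) : ring_iso A B ->
  (forall b : B, b + b ^+ 3 = 0 \/ b - b ^+ 3 = 0) ->
  forall a : A, a + a ^+ 3 = 0 \/ a - a ^+ 3 = 0.
Proof.
move=> [f /bij_inj finj] BI a.
by case: (BI (f a)) => H; [left|right]; apply: finj;
  rewrite rmorph0 ?rmorphB ?rmorphD rmorphXn.
Qed.

(** * The characterization *)

Theorem theorem3p6 (R : pzRingType) :
  yaqub_nil_clean R <->
  nil_subset (jacobson R) /\
  ((exists R1 : pzRingType,
      boolean_ring R1 /\ ring_iso (jacobson_quotient R) R1) \/
   (exists R2 : pzRingType,
      yaqub_ring R2 /\ ring_iso (jacobson_quotient R) R2) \/
   ring_iso (jacobson_quotient R) 'Z_5 \/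
   (exists R1 R2 : pzRingType,
      boolean_ring R1 /\ yaqub_ring R2 /\
      ring_iso (jacobson_quotient R) (R1 * R2)%type) \/
   (exists R1 : pzRingType,
      boolean_ring R1 /\
      ring_iso (jacobson_quotient R) (R1 * 'Z_5)%type)).
Proof.
split=> [RY|[Jnil cases]]; last first.
  apply: (yaqub_identity_nil_clean Jnil).
  case: cases => [[R1 [R1B]]|[[R2 [R2Y]]|[|[[R1 [R2 [R1B [R2Y]]]]|[R1 [R1B]]]]]]
    => /ring_iso_identities; apply.
  - by move=> b; left; have [] := boolean_ring_identities b R1B.
  - by move=> b; right; exact: yaqub_ring_identity.
  - exact: Z5_identities.
  - move=> [b c]; right; have [_ bE] := boolean_ring_identities b R1B.
    by congr (_, _); [exact: bE|exact: yaqub_ring_identity].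
  - move=> [b c]; have [bD bB] := boolean_ring_identities b R1B.
    by case: (Z5_identities c) => cE; [left|right]; congr (_, _).
split; first exact: jacobson_nil.
have projS p :=
  @quotient_proj_surj R (TwoSidedIdeal.clone R (char_kernel p R) _).
have pi2 n : odd n -> char_proj 2 R n%:R = 1.
  move=> n_odd; rewrite -(rmorph1 (char_proj 2 R)).
  apply/quotient_piE/char_kernelP => chi.
  by rewrite rmorphB rmorph_nat rmorph1 -Zp_nat_mod// modn2 n_odd subrr.
have JE x : (x \in jacobsonb R) <-> jacobson R x by split=> /jacobsonbP.
have [[psi _]|no5] := pselect (exists psi : {rmorphism R -> 'Z_5}, True).
  right; right; right; right; exists (char_quotient 2 R).
  split; first exact: char_quotient2_boolean.
  apply: (@quotient_iso_pair _ _ _ _ (char_proj 2 R) psi 5%:R).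
  - exact: projS.
  - exact: character_surj.
  - exact: (pi2 5%N).
  - by rewrite rmorph_nat pchar_Zp.
  move=> x; rewrite JE (jacobson_characters RY) char_proj_eq0.
  split=> [x0|[x2 x5] p].
    by split=> [chi|]; [exact: (x0 2%N)|exact: (x0 5%N)].
  rewrite !inE => /or3P[]/eqP-> chi; first exact: x2.
    by case: (characters_3_5_exclusive RY chi psi).
  exact: (character5_unique RY chi x5).
right; right; right; left; exists (char_quotient 2 R), (char_quotient 3 R).
split; first exact: char_quotient2_boolean.
split; first exact: char_quotient3_yaqub.
apply: (@quotient_iso_pair _ _ _ _ (char_proj 2 R) (char_proj 3 R) 3%:R).
- exact: projS.
- exact: projS.
- exact: (pi2 3%N).
- by apply/char_proj_eq0 => chi; rewrite rmorph_nat pchar_Zp.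
move=> x; rewrite JE (jacobson_characters RY) !char_proj_eq0.
split=> [x0|[x2 x3] p].
  by split=> chi; [exact: (x0 2%N)|exact: (x0 3%N)].
rewrite !inE => /or3P[]/eqP-> chi; [exact: x2|exact: x3|].
by case: no5; exists chi.
Qed.
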